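(* Let $h\colon\mathbb{N}_2\to\mathbb{R}_{\ge0}$ be a convex light weight such that $B_h(1)_1=+\infty$. Then $\lim_{n\to\infty}a_n^h=1$.
   Context: $\mathbb{N}=\{1,2,\dots\}$, $\mathbb{N}_0=\{0,1,2,\dots\}$, and $\mathbb{N}_2=\{e\subset\mathbb{N}:|e|=2\}$. A weight is a map $h\colon\mathbb{N}_2\to\mathbb{C}$ (here with values in $\mathbb{R}_{\ge0}$). A walk of length $n\in\mathbb{N}_0$ is a tuple $w=\langle v_0,\dots,v_n\rangle$ of elements of $\mathbb{N}$ with $v_{i-1}\ne v_i$ for $i=1,\dots,n$; its weight is $h(w)=\prod_{i=1}^n h(\{v_{i-1},v_i\})$ (and $h(w)=1$ if $n=0$). For a set $W$ of walks, $h(W)$ denotes the sum of $\sum_{w\in W}h(w)$ when it converges absolutely. $W(n)$ is the set of walks of length $n$ with $v_0=1$. The weight $h$ is light if $\sum_{w\in W(n)}h(w)$ converges absolutely for every $n\in\mathbb{N}_0$. $V(h)$ is the set of vertices $u\in\mathbb{N}$ such that some walk starting at $1$ and ending at $u$ has nonzero weight. A light weight $h$ is convex if for every $u\in V(h)$, $\sum_{v\in\mathbb{N}\setminus\{u\}}h(\{u,v\})=1$. Define $a_n^h=h(W(1,n))$, where $W(1,n)$ is the set of walks in $W(n)$ with $v_i=1$ for some $i\in\{1,\dots,n\}$; $B_h(x)=\sum_{n\ge0}b_n^hx^n$ with $b_n^h=h(W_b(n))$, where $W_b(n)$ is the set of walks of length $n$ with $v_0=v_n=1$. For $U(x)=\sum_{n\ge0}u_nx^n\in\mathbb{R}[[x]]$,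 $U(1)_1=+\infty$ means $\lim_{n\to\infty}\sum_{j=0}^nu_j=+\infty$. *)

(* Defs.v *)
From mathcomp Require Import all_boot all_order all_algebra finmap.
From mathcomp Require Import all_classical all_reals all_analysis.
Set Implicit Arguments.
Unset Strict Implicit.
Unset Printing Implicit Defensive.
Import Order.TTheory GRing.Theory Num.Theory.
Import numFieldNormedType.Exports.
Local Open Scope classical_set_scope.
Local Open Scope ring_scope.

Definition vertex := {n : nat | (0 < n)%N}.

Definition vertex1 : vertex := exist _ 1%N isT.

Definition edge := {e : {fset vertex} | #|` e | == 2%N}.

Definition weight (R : realType) := edge -> {nonneg R}.

Section Weights.
Context {R : realType}.
Implicit Types (h : weight R) (n : nat) (u v : vertex).

(* h({u, v}) for u != v; the value 0 given when u = v, where [fset u; v] is not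
   an edge, is never used on a walk. *)
Definition edge_weight h u v : R :=
  if insub [fset u; v]%fset is Some e then (h e)%:num else 0.

(* The i-th step of the tuple <v_0, ..., v_n> goes from v_i to v_(i+1). *)
Definition step_src n (w : n.+1.-tuple vertex) (i : 'I_n) : vertex :=
  tnth w (widen_ord (leqnSn n) i).

Definition step_dst n (w : n.+1.-tuple vertex) (i : 'I_n) : vertex :=
  tnth w (lift ord0 i).

Definition is_walk n (w : n.+1.-tuple vertex) : Prop :=
  forall i : 'I_n, step_src w i != step_dst w i.

Definition walk_weight h n (w : n.+1.-tuple vertex) : R :=
  \prod_(i < n) edge_weight h (step_src w i) (step_dst w i).

Definition walks_from1 n : set (n.+1.-tuple vertex) :=
  [set w | is_walk w /\ tnth w ord0 = vertex1].

Definition returning_walks n : set (n.+1.-tuple vertex) :=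
  [set w | walks_from1 w /\
    exists i : 'I_n.+1, (1 <= i)%N /\ tnth w i = vertex1].

Definition closed_walks n : set (n.+1.-tuple vertex) :=
  [set w | is_walk w /\ tnth w ord0 = vertex1 /\ tnth w ord_max = vertex1].

(* Meaningful when the family of weights is summable over W; as the weights are
   nonnegative, the supremum of the finite partial sums is then its sum. *)
Definition set_weight h n (W : set (n.+1.-tuple vertex)) : R :=
  fine (\esum_(w in W) (walk_weight h w)%:E).

Definition light h : Prop :=
  forall n, summable (@walks_from1 n) (fun w => (walk_weight h w)%:E).

Definition reachable h : set vertex :=
  [set u | exists n (w : n.+1.-tuple vertex),
    [/\ walks_from1 w, tnth w ord_max = u & walk_weight h w != 0]].

Definition convex_weight h : Prop :=
  light h /\
  forall u, reachable h u ->
    (\esum_(v in [set v | v != u]) (edge_weight h u v)%:E = 1)%E.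

Definition a_coef h n : R := set_weight h (@returning_walks n).

Definition b_coef h n : R := set_weight h (@closed_walks n).

(* U(1)_1 = +oo for the formal power series U with coefficients u. *)
Definition value_at1_pinfty (u : nat -> R) : Prop :=
  (\sum_(0 <= j < n.+1) u j) @[n --> \oo] --> +oo.

End Weights.

(* Main.v *)
(* A walk of length n is split at its last visit to 1: if s_m denotes the mass of
   the walks of length m that do not return to 1, convexity makes the total mass
   of W(n) equal to 1, so that 1 = sum_(k <= n) b_k s_(n - k).  As s is
   nonincreasing, s_n * sum_(k <= n) b_k <= 1, and a_n = 1 - s_n. *)

Require Import Defs.
From mathcomp Require Import all_boot all_order all_algebra.
From mathcomp Require Import all_classical all_reals all_analysis.
Import Order.TTheory GRing.Theory Num.Theory.
Import numFieldNormedType.Exports.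
Local Open Scope classical_set_scope.
Local Open Scope ring_scope.

(** * Weighted sums over tuples, computed one step at a time *)

Lemma esumZl {R : realType} {T : choiceType} (D : set T) (c : R)
    (a : T -> \bar R) : 0 <= c -> (forall i, (0 <= a i)%E) ->
  (\esum_(i in D) (c%:E * a i) = c%:E * \esum_(i in D) a i)%E.
Proof.
(* Only this inequality is proved from the finite partial sums; the converse is the same inequality
   for the factor [c^-1], when [c] is nonzero. *)
have le_scale (k : R) (f : T -> \bar R) : 0 <= k -> (forall i, (0 <= f i)%E) ->
    (\esum_(i in D) (k%:E * f i) <= k%:E * \esum_(i in D) f i)%E.
  move=> k0 f0; apply: ge_ereal_sup => _ [X [finX XD] <-].
  rewrite -ge0_mule_fsumr//; apply: lee_wpmul2l; first by rewrite lee_fin.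
  by apply: ereal_sup_ubound; exists X.
move=> c0 a0; apply/eqP; rewrite eq_le le_scale//=.
have [->|c_neq0] := eqVneq c 0.
  by rewrite mul0e; apply: esum_ge0 => i _; rewrite mul0e.
have -> : (\esum_(i in D) a i = \esum_(i in D) (c^-1%:E * (c%:E * a i)))%E.
  by apply: eq_esum => i _; rewrite muleA -EFinM mulVf// mul1e.
apply: (@le_trans _ _ (c%:E * (c^-1%:E * \esum_(i in D) (c%:E * a i))))%E.
  apply: lee_wpmul2l; rewrite ?lee_fin// le_scale ?invr_ge0// => i.
  by rewrite mule_ge0// lee_fin.
by rewrite muleA -EFinM divff// mul1e.
Qed.

(** This is the [n]-th power of the operator with kernel [q], applied to the terminal function [g].
    Values in the extended reals spare any summability condition at each step. *)
Fixpoint walk_mass {R : realType} (q : vertex -> vertex -> R)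
    (g : vertex -> R) (n : nat) (u : vertex) : \bar R :=
  if n is m.+1 then
    (\esum_(v in [set: vertex]) ((q u v)%:E * walk_mass q g m v))%E
  else (g u)%:E.

Lemma walk_mass_ge0 {R : realType} (q : vertex -> vertex -> R)
    (g : vertex -> R) n u :
  (forall u v, 0 <= q u v) -> (forall u, 0 <= g u) ->
  (0 <= walk_mass q g n u)%E.
Proof.
move=> q0 g0; elim: n u => [|n IHn] u /=; first by rewrite lee_fin.
by apply: esum_ge0 => v _; rewrite mule_ge0 ?lee_fin.
Qed.

Lemma esum_walk_mass {R : realType} (q : vertex -> vertex -> R)
    (g : vertex -> R) n u :
  (forall u v, 0 <= q u v) -> (forall u, 0 <= g u) ->
  (\esum_(w in [set w : n.+1.-tuple vertex | tnth w ord0 = u])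
     ((\prod_(i < n) q (step_src w i) (step_dst w i)) * g (tnth w ord_max))%:E
   = walk_mass q g n u)%E.
Proof.
move=> q0 g0; elim: n u => [|n IHn] u.
  rewrite (_ : [set w | _] = [set [tuple u]]); last first.
    apply/seteqP; split=> [w /= <-|w /= ->].
      by apply: eq_from_tnth => i; rewrite ord1 [RHS]tnth0.
    by rewrite tnth0.
  by rewrite esum_set1 ?big_ord0 ?mul1r ?lee_fin//=.
pose F m (w : m.+1.-tuple vertex) :=
  (\prod_(i < m) q (step_src w i) (step_dst w i)) * g (tnth w ord_max).
have F0 m w : 0 <= F m w by rewrite mulr_ge0// prodr_ge0.
rewrite -/(F _) /=.
have step v : ((q u v)%:E * walk_mass q g n v =
    \esum_(w in [set w : n.+1.-tuple vertex | tnth w ord0 = v])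
      ((q u v)%:E * (F n w)%:E))%E.
  by rewrite -IHn esumZl// => w; rewrite lee_fin.
under [RHS]eq_esum do rewrite step.
rewrite esum_esum; last by move=> v w _ _; rewrite mule_ge0 ?lee_fin.
(* A tuple starting at [u] corresponds to its tail [w], paired with the first vertex [v] of that
   tail. *)
rewrite (reindex_esum
  (setT `*`` fun v => [set w : n.+1.-tuple vertex | tnth w ord0 = v]) _
  (fun k => [tuple of u :: k.2])).
  apply: eq_esum => -[v w] /= [_ wv].
  rewrite -EFinM; congr (_%:E); rewrite /F big_ord_recl -mulrA; congr (_ * _).
    by rewrite -wv; congr (q _ _); rewrite /step_src /step_dst !(tnth_nth u).
  congr (_ * _).
    apply: eq_bigr => i _; congr (q _ _).
      by rewrite /step_src !(tnth_nth u).
    by rewrite /step_dst !(tnth_nth u).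
  by rewrite !(tnth_nth u).
split.
- by move=> [v w] /= _; rewrite tnth0.
- move=> [v w] [v' w'] /=; rewrite !inE /= => -[_ <-] [_ <-].
  move=> /(congr1 val) /= [] ww.
  by rewrite (val_inj ww).
- move=> w; case/tupleP: w => x w /=; rewrite tnth0 => <-.
  by exists (tnth w ord0, w).
Qed.

(** * Kernels attached to the weight, and reachable vertices *)

Section ConvexWeight.
Context {R : realType} (h : weight R).

Let one := fun _ : vertex => 1 : R.
Let at1 := fun v : vertex => (v == vertex1)%:R : R.

(* Steps into the vertex 1 are killed, so that the mass of the walks from [u] of
   length [n] is carried by those which avoid 1 at positive times. *)
Definition taboo_weight (u v : vertex) : R :=
  edge_weight h u v * (v != vertex1)%:R.

Definition taboo_mass n (u : vertex) : \bar R := walk_mass taboo_weight one n u.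

(** Earlier visits to 1 are allowed: this is an [n]-step transition mass into 1, not a first-passage
    mass. *)
Definition hit_mass n (u : vertex) : \bar R :=
  walk_mass (edge_weight h) at1 n u.

Lemma edge_weight_ge0 u v : 0 <= edge_weight h u v.
Proof. by rewrite /edge_weight; case: insubP. Qed.

Lemma edge_weightxx u : edge_weight h u u = 0.
Proof. by rewrite /edge_weight finmap.fsetUid insubN// finmap.cardfs1. Qed.

Lemma taboo_weight_ge0 u v : 0 <= taboo_weight u v.
Proof. by rewrite mulr_ge0// edge_weight_ge0. Qed.

Lemma walk_weight_ge0 n (w : n.+1.-tuple vertex) : 0 <= walk_weight h w.
Proof. by apply: prodr_ge0 => i _; exact: edge_weight_ge0. Qed.

(** A step from a vertex to itself has the default weight 0. Hence sums over walks may be replaced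
    by sums over all tuples. *)
Lemma walk_weight_neq0 n (w : n.+1.-tuple vertex) :
  walk_weight h w != 0 -> is_walk w.
Proof.
move=> /prodf_neq0 w0 i; apply: contra (w0 i isT) => /eqP ->.
by rewrite edge_weightxx.
Qed.

Lemma hit_mass_ge0 n u : (0 <= hit_mass n u)%E.
Proof.
by apply: walk_mass_ge0 => *; [exact: edge_weight_ge0 | rewrite /at1].
Qed.

Lemma taboo_mass_ge0 n u : (0 <= taboo_mass n u)%E.
Proof.
by apply: walk_mass_ge0 => *; [exact: taboo_weight_ge0 | rewrite /one].
Qed.

Lemma reachable1 : reachable h vertex1.
Proof.
exists 0%N, [tuple vertex1]; split; rewrite ?tnth0//.
- by split => [[]//|]; rewrite tnth0.
- by rewrite /walk_weight big_ord0 oner_neq0.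
Qed.

(** Appending [v] to a walk of nonzero weight ending at [u] keeps the weight nonzero. Inductions on
    the first step thus stay among the vertices where convexity holds. *)
Lemma reachable_step u v :
  reachable h u -> edge_weight h u v != 0 -> reachable h v.
Proof.
move=> [n [w [[_ w1] wu w0]]] uv0.
pose w' : n.+2.-tuple vertex := [tuple of rcons w v].
have w'w (i : 'I_n.+1) : tnth w' (widen_ord (leqnSn n.+1) i) = tnth w i.
  by rewrite !(tnth_nth vertex1) /= nth_rcons size_tuple ltn_ord.
have w'max : tnth w' ord_max = v.
  by rewrite (tnth_nth vertex1) /= nth_rcons size_tuple ltnn eqxx.
have ww' : walk_weight h w' = walk_weight h w * edge_weight h u v.
  rewrite /walk_weight big_ord_recr /=; congr (_ * edge_weight _ _ _).
  - apply: eq_bigr => i _; rewrite /step_src /step_dst; congr edge_weight.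
      by rewrite -w'w; congr tnth; exact: val_inj.
    by rewrite -w'w; congr tnth; exact: val_inj.
  - by rewrite -wu -w'w; congr tnth; exact: val_inj.
  - by rewrite -w'max; congr tnth; exact: val_inj.
have w'0 : walk_weight h w' != 0 by rewrite ww' mulf_neq0.
exists n.+1, w'; split => //; split; first exact: walk_weight_neq0.
by rewrite -w1 -w'w; congr tnth; exact: val_inj.
Qed.

(** * Consequences of convexity *)

Hypothesis h_convex : convex_weight h.

Lemma esum_edge_weight u : reachable h u ->
  (\esum_(v in [set: vertex]) (edge_weight h u v)%:E = 1)%E.
Proof.
move=> /(h_convex.2) <-; rewrite [RHS]esum_mkcond; apply: eq_esum => v _.
case: ifPn => //; rewrite notin_setE /= => /negP; rewrite negbK => /eqP ->.
by rewrite edge_weightxx.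
Qed.

(** On reachable vertices the kernel is stochastic, and it gives no mass to steps leaving them, so
    the constant function 1 is preserved there. *)
Lemma walk_mass1 n u : reachable h u -> walk_mass (edge_weight h) one n u = 1%E.
Proof.
elim: n u => [//|n IHn] u hu /=; rewrite -(esum_edge_weight _ hu).
apply: eq_esum => v _; have [->|uv0] := eqVneq (edge_weight h u v) 0.
  by rewrite mul0e.
by rewrite IHn ?mule1//; exact: reachable_step _ _ hu uv0.
Qed.

Lemma taboo_mass_le1 n u : reachable h u -> (taboo_mass n u <= 1)%E.
Proof.
elim: n u => [//|n IHn] u hu /=; rewrite -(esum_edge_weight _ hu).
apply: le_esum => v _; rewrite /taboo_weight.
have [->|uv0] := eqVneq (edge_weight h u v) 0.
  by rewrite mul0r mul0e.
have := IHn _ (reachable_step _ _ hu uv0); rewrite -/(taboo_mass _ _).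
case: (v == vertex1); rewrite ?mulr0 ?mul0e ?lee_fin ?edge_weight_ge0//=.
rewrite mulr1 => le1; rewrite -[leRHS]mule1.
by apply: lee_wpmul2l le1; rewrite lee_fin edge_weight_ge0.
Qed.

(** The taboo kernel is substochastic on reachable vertices, so one application brings the constant
    1 below itself; a nonnegative kernel preserves this inequality under iteration. *)
Lemma taboo_massS_le n u : reachable h u ->
  (taboo_mass n.+1 u <= taboo_mass n u)%E.
Proof.
elim: n u => [|n IHn] u hu; first exact: taboo_mass_le1.
rewrite {1}/taboo_mass [in leRHS]/taboo_mass.
rewrite [leLHS]/= -/(walk_mass _ _ n.+1) [leRHS]/=.
apply: le_esum => v _.
have [uv0|uv0] := eqVneq (edge_weight h u v) 0.
  by rewrite /taboo_weight uv0 mul0r !mul0e.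
apply: lee_wpmul2l; first by rewrite lee_fin taboo_weight_ge0.
exact: IHn (reachable_step _ _ hu uv0).
Qed.

Lemma taboo_mass_nincr m n u : reachable h u -> (m <= n)%N ->
  (taboo_mass n u <= taboo_mass m u)%E.
Proof.
move=> hu /subnK <-; elim: (n - m)%N => [//|k IHk].
exact: le_trans (taboo_massS_le _ _ hu) IHk.
Qed.

Lemma taboo_mass_fin_num n u : reachable h u -> taboo_mass n u \is a fin_num.
Proof.
move=> hu; rewrite ge0_fin_numE ?taboo_mass_ge0//.
by apply: le_lt_trans (taboo_mass_le1 _ _ hu) _; rewrite ltry.
Qed.

(* Decomposition according to the last visit to 1 at a positive time. *)
Lemma last_visit n u : reachable h u ->
  (taboo_mass n u +
   \sum_(k < n) hit_mass k.+1 u * taboo_mass (n - k.+1) vertex1 = 1)%E.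
Proof.
elim: n u => [|n IHn] u hu; first by rewrite big_ord0 adde0.
have s_ge0 := taboo_mass_ge0.
have b_ge0 := hit_mass_ge0.
have p_ge0 := edge_weight_ge0.
(* Scaling of sums is available for real factors only, hence the passage through [fine]. *)
have sE k : taboo_mass k vertex1 = (fine (taboo_mass k vertex1))%:E.
  by rewrite fineK// taboo_mass_fin_num//; exact: reachable1.
have hitS k m : (hit_mass k.+1 u * taboo_mass m vertex1 =
    \esum_(v in [set: vertex])
      ((edge_weight h u v)%:E * (hit_mass k v * taboo_mass m vertex1)))%E.
  rewrite muleC sE -esumZl; last 2 first.
  - by rewrite fine_ge0.
  - by move=> v; rewrite mule_ge0 ?lee_fin// hit_mass_ge0.
  by apply: eq_esum => v _; rewrite muleC -muleA.
(* Writing 1 as the mass of all walks of length [n.+1] turns both sides into sums over the first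
   step [v], to be compared term by term. *)
rewrite -(walk_mass1 n.+1 u hu) /= /bump /=.
under eq_bigr do rewrite hitS.
rewrite -esum_sum; last by move=> *; rewrite !mule_ge0 ?lee_fin.
rewrite /taboo_mass [walk_mass _ _ n.+1 u]/= -/(taboo_mass _).
rewrite -esumD; last 2 first.
- by move=> v _; rewrite mule_ge0 ?lee_fin ?taboo_weight_ge0// taboo_mass_ge0.
- by move=> v _; apply: sume_ge0 => k _; rewrite !mule_ge0 ?lee_fin.
apply: eq_esum => v _.
have [uv0|uv0] := eqVneq (edge_weight h u v) 0.
  rewrite /taboo_weight uv0 mul0r !mul0e add0e big1// => k _.
  by rewrite mul0e.
have hv := reachable_step _ _ hu uv0.
rewrite walk_mass1// -(IHn v hv) -ge0_sume_distrr; last first.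
  by move=> k _; rewrite mule_ge0.
(* The term [k = 0] is split off: it vanishes unless [v] is 1, and then it restores exactly the mass
   killed by the taboo kernel. The remaining terms are those of the induction hypothesis at [v]. *)
rewrite big_ord_recl /= subSS subn0.
rewrite /taboo_weight EFinM -muleA -ge0_muleDr; last 2 first.
- by rewrite mule_ge0 ?lee_fin// s_ge0.
- by rewrite adde_ge0 ?mule_ge0 ?sume_ge0// => k _; rewrite mule_ge0.
congr (_ * _)%E; rewrite addeA; congr (_ + _)%E.
rewrite /hit_mass /= /at1 /taboo_mass.
by case: eqVneq => [->|_]; rewrite ?mul0e ?mul1e ?add0e ?adde0.
Qed.

(** * From kernel masses back to the sets of walks *)

Lemma esum_closed_walks n :
  (\esum_(w in @closed_walks n) (walk_weight h w)%:E = hit_mass n vertex1)%E.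
Proof.
rewrite /hit_mass -esum_walk_mass;
  [|exact: edge_weight_ge0|by move=> v; rewrite /at1].
rewrite (_ : @closed_walks n = [set w | tnth w ord0 = vertex1] `&`
    [set w | is_walk w /\ tnth w ord_max = vertex1]); last first.
  by apply/seteqP; split=> w /=; rewrite /closed_walks /=; tauto.
rewrite esum_mkcondr; apply: eq_esum => w _; rewrite -/(walk_weight h w) /at1.
case: ifPn => [|].
  by rewrite inE /= => -[_ ->]; rewrite eqxx mulr1.
rewrite notin_setE /= => nw.
have [w1|_] := eqVneq (tnth w ord_max) vertex1; last by rewrite mulr0.
have [->|/walk_weight_neq0 ww] := eqVneq (walk_weight h w) 0.
  by rewrite mul0r.
by exfalso; apply: nw.
Qed.

Lemma esum_walks_from1 n :
  (\esum_(w in @walks_from1 n) (walk_weight h w)%:E = 1)%E.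
Proof.
rewrite -(walk_mass1 n vertex1 reachable1) -esum_walk_mass;
  [|exact: edge_weight_ge0|by move=> v; rewrite /one].
rewrite (_ : @walks_from1 n = [set w | tnth w ord0 = vertex1] `&`
    [set w | is_walk w]); last first.
  by apply/seteqP; split=> w /=; rewrite /walks_from1 /=; tauto.
rewrite esum_mkcondr; apply: eq_esum => w _; rewrite -/(walk_weight h w) mulr1.
case: ifPn => //; rewrite notin_setE /= => nw.
by have [->//|/walk_weight_neq0] := eqVneq (walk_weight h w) 0.
Qed.

(** The product of taboo weights is the walk weight times the indicators that each step avoids 1. A
    tuple outside the set either contains a loop step or has a vanishing indicator. *)
Lemma esum_avoiding n :
  (\esum_(w in @walks_from1 n `&` ~` @returning_walks n) (walk_weight h w)%:E =
   taboo_mass n vertex1)%E.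
Proof.
rewrite /taboo_mass -esum_walk_mass;
  [|exact: taboo_weight_ge0|by move=> v; rewrite /one].
rewrite (_ : _ `&` _ = [set w : n.+1.-tuple vertex | tnth w ord0 = vertex1] `&`
    [set w | is_walk w /\ forall i, step_dst w i != vertex1]); last first.
  apply/seteqP; split=> w /=.
    move=> [[ww w1] nr]; split=> //; split=> // i; apply/negP => /eqP wi.
    by apply: nr; split=> //; exists (lift ord0 i).
  move=> [w1 [ww nr]]; split=> // -[_ [i [i_gt0 wi]]].
  (* A positive position is the destination of some step; position 0 is excluded by [i_gt0]. *)
  case: (unliftP ord0 i) i_gt0 wi => [j ->|->//] _ wj.
  by have := nr j; rewrite /step_dst wj eqxx.
rewrite esum_mkcondr; apply: eq_esum => w _; rewrite mulr1 big_split /=.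
rewrite -/(walk_weight h w).
case: ifPn => [|].
  rewrite inE /= => -[_ nr].
  by rewrite [X in _ * X]big1 ?mulr1// => i _; rewrite nr.
rewrite notin_setE /= => nw.
have [->|/walk_weight_neq0 ww] := eqVneq (walk_weight h w) 0.
  by rewrite mul0r.
have [i wi] : exists i, step_dst w i = vertex1.
  apply: contra_notP nw => nr; split=> // i.
  by apply/negP => /eqP wi; apply: nr; exists i.
by rewrite (bigD1 i) //= wi eqxx mul0r mulr0.
Qed.

Lemma a_coefE n : a_coef h n = 1 - fine (taboo_mass n vertex1).
Proof.
have := esum_walks_from1 n.
rewrite (esumID (@returning_walks n)); last first.
  by move=> w _; rewrite lee_fin walk_weight_ge0.
rewrite esum_avoiding (_ : _ `&` _ = @returning_walks n); last first.
  by apply/seteqP; split=> w /= [] //; move=> *; split.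
rewrite /a_coef /set_weight -(fineK (taboo_mass_fin_num n vertex1 reachable1)).
(* An infinite value could not sum to 1 with a finite one, so [fine] loses nothing here. *)
case: esum => [x| |] //= [<-].
by rewrite addrK.
Qed.

Lemma taboo_mass_mul_sum_b_coef n :
  fine (taboo_mass n vertex1) * \sum_(0 <= k < n.+1) b_coef h k <= 1.
Proof.
(* Closed walks lie among the walks from 1, whose total mass is 1; their mass is therefore
   finite. *)
have bE k : (b_coef h k)%:E = hit_mass k vertex1.
  rewrite /b_coef /set_weight esum_closed_walks fineK// ge0_fin_numE;
    last exact: hit_mass_ge0.
  rewrite -esum_closed_walks; apply: (@le_lt_trans _ _ 1%E); last by rewrite ltry.
  rewrite -(esum_walks_from1 k).
  rewrite (esumID (@closed_walks k) (@walks_from1 k)); last first.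
    by move=> w _; rewrite lee_fin walk_weight_ge0.
  rewrite (_ : _ `&` _ = @closed_walks k); last first.
    by apply/seteqP; split=> w /= => [[]//|[? [? ?]]].
  rewrite leeDl// esum_ge0// => w _; by rewrite lee_fin walk_weight_ge0.
rewrite -lee_fin EFinM fineK ?taboo_mass_fin_num//; last exact: reachable1.
rewrite -(last_visit n vertex1 reachable1) big_mkord -sumEFin.
rewrite ge0_sume_distrr; last first.
  by move=> k _; rewrite bE hit_mass_ge0.
(* Since [b_coef h 0] is 1, the term [k = 0] matches the isolated [taboo_mass] of the last-visit
   identity; the other terms are compared one by one. *)
rewrite big_ord_recl bE /hit_mass /= /at1 eqxx mule1 leeD2l//.
apply: lee_sum => k _; rewrite /bump /= bE muleC.
apply: lee_wpmul2l; first exact: hit_mass_ge0.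
apply: taboo_mass_nincr; [exact: reachable1 | exact: leq_subr].
Qed.

End ConvexWeight.

Theorem theorem6 (R : realType) (h : weight R)
    (h_convex : convex_weight h)
    (hB : value_at1_pinfty (b_coef h)) :
  a_coef h n @[n --> \oo] --> (1 : R).
Proof.
rewrite (_ : a_coef h = fun n => 1 - fine (taboo_mass h n vertex1)); last first.
  by apply/funext => n; exact: a_coefE.
rewrite -[X in _ --> X]subr0; apply: cvgB; first exact: cvg_cst.
apply/cvgrPdist_le => e e0.
(* The threshold [e^-1] is chosen so that a partial sum above it forces the avoiding mass times
   [e^-1] to be at most 1, hence that mass to be at most [e]. *)
move/cvgryPge: hB => /(_ e^-1); apply: filterS => n Be.
have s0 : 0 <= fine (taboo_mass h n vertex1) by rewrite fine_ge0 ?taboo_mass_ge0.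
rewrite sub0r normrN ger0_norm//.
have := taboo_mass_mul_sum_b_coef _ h_convex n.
move/(le_trans (ler_wpM2l s0 Be)).
by rewrite ler_pdivrMr// mul1r.
Qed.
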